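(* Let $r\ge 1$ and $d\ge 2$ be integers such that $r$ divides $d$. Let $J\subseteq R=\mathbf C[a_0,\dots,a_d]$ be the ideal generated by the coefficients $h_0,\dots,h_N$ of the Hilbert covariant $\mathcal H_{r,d}$, and let $X=X_{r,d}\subseteq\mathbf P^d$ be the variety of binary forms of order $d$ which are perfect $(d/r)$-th powers of forms of order $r$. Then the saturation of $J$ (with respect to the irrelevant ideal $(a_0,\dots,a_d)$) coincides with the homogeneous defining ideal $I_X\subseteq R$ of $X$.
   Context: The base field is $\mathbf C$. For $p\ge0$, $S_p$ is the $(p+1)$-dimensional space of binary forms of order (homogeneous degree) $p$ in $x_1,x_2$. A form $F=\sum_{i=0}^d\binom di a_i x_1^{d-i}x_2^i$ corresponds to the point $[a_0:\dots:a_d]$ of $\mathbf P S_d\simeq\mathbf P^d$, so $R=\mathbf C[a_0,\dots,a_d]$ is the homogeneous coordinate ring of $\mathbf P S_d$. With $r\mid d$ and $\mu=d/r$, $X=X_{r,d}$ is the image of the embedding $\mathbf P S_r\to\mathbf P S_d$, $[G]\mapsto[G^\mu]$, and $I_X$ is the ideal generated by all homogeneous polynomials in $R$ vanishing on $X$. Hilbert covariant: put $N=(r+1)(d-2)$ and $E_+=\sum_{i=0}^{d-1}(d-i)\,a_{i+1}\frac{\partial}{\partial a_i}$. It acts as a derivation also on expressions involving rational powers of $a_0$, with $E_+(a_0^s)=s\,d\,a_0^{s-1}a_1$. Define $h_0=a_0^{\,r+1-\frac rd}\,E_+^{\,r+1}\bigl(a_0^{\frac rd}\bigr)$, which is a polynomial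 in the $a_i$, and $h_k=\frac{(N-k)!}{N!}E_+^k(h_0)$ for $0\le k\le N$. Then $\mathcal H_{r,d}=\sum_{k=0}^N\binom Nk h_k\,x_1^{N-k}x_2^k$. *)

(* Defs.v *)
(* The field of complex numbers is R[i] for R : realType. *)
From mathcomp Require Import all_boot all_order all_algebra.
From mathcomp Require Import mpoly ring.
From mathcomp Require Export complex.
From mathcomp Require Export reals.

Set Implicit Arguments.
Unset Strict Implicit.
Unset Printing Implicit Defensive.

Import GRing.Theory.
Local Open Scope ring_scope.

Section Ideals.
Variable A : comNzRingType.

Definition ideal_gen (S : A -> Prop) (f : A) : Prop :=
  exists (n : nat) (q g : 'I_n -> A),
    (forall i, S (g i)) /\ f = \sum_(i < n) q i * g i.

Fixpoint ideal_pow (I : A -> Prop) (n : nat) : A -> Prop :=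
  if n is m.+1 then
    ideal_gen (fun f => exists g h, [/\ ideal_pow I m g, I h & f = g * h])
  else fun=> True.

(* The union over n of the ideal quotients (J : I^n). *)
Definition saturation (J I : A -> Prop) (f : A) : Prop :=
  exists n : nat, forall g, ideal_pow I n g -> J (g * f).

End Ideals.

(* \sum_i 'C(n, i) c_i x_1^(n-i) x_2^i. *)
Definition binary_form (A : comNzRingType) (n : nat) (c : 'I_n.+1 -> A) :
    {mpoly A[2]} :=
  \sum_(i < n.+1) ('C(n, i)%:R * c i) *: ('X_ord0 ^+ (n - i) * 'X_ord_max ^+ i).

Lemma binary_form_coef (A : comNzRingType) (n : nat) (c : 'I_n.+1 -> A)
    (i : 'I_n.+1) :
  (binary_form c)@_(U_(ord0) *+ (n - i) + U_(ord_max) *+ i)%MM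
    = 'C(n, i)%:R * c i.
Proof.
rewrite /binary_form raddf_sum (bigD1 i) //= big1 => [|j neq_ji].
  by rewrite addr0 mcoeffZ !mpolyXn -mpolyXD mcoeffX eqxx mulr1.
rewrite mcoeffZ !mpolyXn -mpolyXD mcoeffX.
case: eqP => [/mnmP/(_ ord_max)|]; last by rewrite mulr0.
rewrite !mnmDE !mulmnE !mnm1E /= !mul0n !mul1n !add0n => eq_ji.
by rewrite -(inj_eq val_inj) /= eq_ji eqxx in neq_ji.
Qed.

Section HilbertCovariant.
Variables (K : fieldType) (r d : nat).

Local Notation P := {mpoly K[d.+1]}.

Definition a_ (i : nat) : P := 'X_(inord i).

Definition Eplus (p : P) : P :=
  \sum_(i < d) (d - i)%:R *: (a_ i.+1 * p^`M(inord i)).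

(* The pair (s, p) stands for the expression a_0^s * p, so that (s, a_0 * p)
   and (s + 1, p) stand for the same expression. *)
Definition powexpr : Type := (rat * P)%type.

Definition powexpr_mul (u v : powexpr) : powexpr := (u.1 + v.1, u.2 * v.2).

Definition a0pow (s : rat) : powexpr := (s, 1).

(* Leibniz rule for a_0^s * p with E_+(a_0^s) = s d a_0^(s-1) a_1, the factor
   a_0^(s-1) being taken out. *)
Definition powexpr_Eplus (u : powexpr) : powexpr :=
  (u.1 - 1, (ratr u.1 * d%:R) *: (a_ 1 * u.2) + a_ 0 * Eplus u.2).

Definition h0_expr : powexpr :=
  powexpr_mul (a0pow (r.+1%:R - r%:R / d%:R))
              (iter r.+1 powexpr_Eplus (a0pow (r%:R / d%:R))).

(* h_0 is a polynomial: the exponent left over is 0. *)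
Lemma h0_expr_exponent : h0_expr.1 = 0.
Proof.
have iterE n s : (iter n powexpr_Eplus (a0pow s)).1 = s - n%:R.
  elim: n => [|n IHn] /=; first by rewrite subr0.
  by rewrite IHn -addn1 natrD opprD addrA.
have -> : h0_expr.1 = (r.+1%:R - r%:R / d%:R)
    + (iter r.+1 powexpr_Eplus (a0pow (r%:R / d%:R))).1 by [].
by rewrite iterE -opprB addNr.
Qed.

Definition h0 : P := h0_expr.2.

Definition covariant_order : nat := (r.+1 * (d - 2))%N.

Definition h_ (k : nat) : P :=
  ((covariant_order - k)`!%:R / covariant_order`!%:R) *: iter k Eplus h0.

Definition hilbert_covariant : {mpoly P[2]} :=
  binary_form (fun k : 'I_covariant_order.+1 => h_ k).

Definition hilbert_ideal : P -> Prop :=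
  ideal_gen (fun f => exists2 k : nat, (k <= covariant_order)%N & f = h_ k).

Definition irrelevant_ideal : P -> Prop :=
  ideal_gen (fun f => exists i : 'I_d.+1, f = 'X_i).

(* The homogeneous coordinate vectors a of the points of X_{r,d}: the point
   [a_0 : ... : a_d] is the class of \sum_i 'C(d, i) a_i x_1^(d-i) x_2^i. *)
Definition in_power_locus (a : 'I_d.+1 -> K) : Prop :=
  (exists i, a i != 0) /\
  exists G : {mpoly K[2]},
    [/\ G \is r.-homog, G != 0
      & exists2 c : K, c != 0 & binary_form a = c *: G ^+ (d %/ r)].

Definition power_locus_ideal : P -> Prop :=
  ideal_gen (fun f => (exists k : nat, f \is k.-homog) /\
                      forall a, in_power_locus a -> f.@[a] = 0).

End HilbertCovariant.

Section Derivation.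
Variables (K : numFieldType) (d : nat).
Implicit Types (p q : {mpoly K[d.+1]}) (u v : powexpr K d).

Lemma EplusM p q : Eplus (p * q) = Eplus p * q + p * Eplus q.
Proof.
rewrite /Eplus mulr_suml mulr_sumr -big_split /=; apply: eq_bigr => i _.
by rewrite mderivM -!mul_mpolyC; ring.
Qed.

Lemma powexpr_EplusM u v :
  powexpr_Eplus (powexpr_mul u v)
    = (u.1 + v.1 - 1, (powexpr_Eplus u).2 * v.2 + u.2 * (powexpr_Eplus v).2).
Proof.
case: u v => [s p] [t q].
rewrite /powexpr_Eplus /powexpr_mul /= EplusM rmorphD /=; congr pair.
move: (ratr s) (ratr t) => x y.
by rewrite -!mul_mpolyC !mpolyCM mpolyCD; ring.
Qed.

Lemma Eplus_a0 : (0 < d)%N -> Eplus (a_ K d 0) = d%:R *: a_ K d 1.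
Proof.
move=> d_gt0; rewrite /Eplus (bigD1 (Ordinal d_gt0)) //= big1 => [|i i_neq0].
  rewrite /a_ mderivX mnm1E eqxx scale1r addr0 subn0.
  by rewrite -{1}[U_(inord 0)%MM]add0m addmK mpolyX0 mulr1.
rewrite /a_ mderivX mnm1E -(inj_eq val_inj) /= !inordK // ?ltnS 1?ltnW //.
rewrite eq_sym; move: i_neq0; rewrite -(inj_eq val_inj) /= => /negPf ->.
by rewrite scale0r mulr0 scaler0.
Qed.

(* E_+ gives the same result on both representatives of a_0^(s+1) * p. *)
Lemma powexpr_Eplus_a0 (s : rat) p : (0 < d)%N ->
  (powexpr_Eplus (s, a_ K d 0 * p)).2 = a_ K d 0 * (powexpr_Eplus (s + 1, p)).2.
Proof.
move=> d_gt0; rewrite /powexpr_Eplus /= EplusM Eplus_a0 //.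
rewrite rmorphD rmorph1 /=; move: (ratr s) => x.
by rewrite -!mul_mpolyC !mpolyCM mpolyCD; ring.
Qed.

End Derivation.

(* Main.v *)
Require Import Defs.
From mathcomp Require Import all_boot all_order all_algebra.
From mathcomp Require Import mpoly ring.

(** Write c_k = a_0^(k - r/d) E_+^k(a_0^(r/d)), so that h_0 = c_(r+1). Up to a
    unit and terms in a_0, ..., a_(k-1), c_k is a_0^(k-1) a_k, so on a_0 <> 0
    the c_k with k <= d are coordinates. There J contains c_(r+1), ..., c_d,
    since c_(k+1) is a combination of c_k and E_+ c_k; and the values of
    a_0, ..., a_r on X are arbitrary, by extracting a truncated (d/r)-th root.
    Hence every f vanishing on X satisfies a_0^n f in J for some n.
    As h_0 is a lowest weight vector of weight N for sl2, E_+^(N+1) h_0 = 0 and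
    J is E_+-stable. Since E_+ is locally nilpotent, the g with g E_+^k(f) in J
    for all k form an E_+-stable ideal containing a power of a_0; in
    characteristic 0 its radical is E_+-stable too, so it contains
    a_0, a_1, ..., a_d and f lies in the saturation.
    Conversely, E_+ is differentiation along the translations of
    f = F(1, t), so h_0 becomes f^(r+1-r/d) (f^(r/d))^(r+1), which vanishes when
    f^(r/d) is a polynomial of degree at most r. *)

Set Implicit Arguments.
Unset Strict Implicit.
Unset Printing Implicit Defensive.

Import GRing.Theory Num.Theory.
Local Open Scope ring_scope.

(** * Induction on generators and derivations of polynomial rings *)

Lemma mpoly_gen_ind (n : nat) (R : comNzRingType) (Q : {mpoly R[n]} -> Prop) :
    (forall c, Q c%:MP) -> (forall i, Q 'X_i) ->
    (forall p q, Q p -> Q q -> Q (p + q)) ->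
    (forall p q, Q p -> Q q -> Q (p * q)) ->
  forall p, Q p.
Proof.
move=> QC QX QD QM; elim/mpolyind => [|c m p _ _ Qp].
  by rewrite -mpolyC0.
apply: QD => //; rewrite -mul_mpolyC mpolyXE_id; apply: (QM) => //.
apply: (big_ind Q) => [||i _]; [by rewrite -mpolyC1 | exact: QM |].
by elim: (m i) => [|k IHk]; rewrite ?exprS ?expr0 -?mpolyC1 //; apply: (QM).
Qed.

Section Derivations.
Variables (n : nat) (R : comNzRingType).
Local Notation P := {mpoly R[n]}.
Implicit Types (v : 'I_n -> P) (p q : P).

Definition der v p : P := \sum_i v i * p^`M(i).

Lemma derD v p q : der v (p + q) = der v p + der v q.
Proof.
by rewrite /der -big_split; apply: eq_bigr => i _; rewrite mderivD mulrDr.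
Qed.

Lemma derM v p q : der v (p * q) = der v p * q + p * der v q.
Proof.
rewrite /der mulr_suml mulr_sumr -big_split; apply: eq_bigr => i _ /=.
by rewrite mderivM; ring.
Qed.

Lemma derC v c : der v c%:MP = 0.
Proof. by rewrite /der big1 // => i _; rewrite mderivC mulr0. Qed.

Lemma der0 v : der v 0 = 0.
Proof. by rewrite -mpolyC0 derC. Qed.

Lemma derX v i : der v 'X_i = v i.
Proof.
rewrite /der (bigD1 i) //= big1 => [|j neq_ji].
  by rewrite mderivX mnm1E eqxx scale1r -{1}[U_(i)%MM]add0m addmK mpolyX0
    mulr1 addr0.
by rewrite mderivX mnm1E eq_sym (negPf neq_ji) scale0r mulr0.
Qed.

End Derivations.

(** * The sl2-action on R and its effect on powers of a_0 *)

Section Sl2.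
Variables (K : numFieldType) (d : nat).
Local Notation P := {mpoly K[d.+1]}.
Local Notation a := (a_ K d).
Local Notation E := (@Eplus K d).
Implicit Types p q : P.

Lemma mpoly_a_ind (Q : P -> Prop) :
    (forall c, Q c%:MP) -> (forall i, (i <= d)%N -> Q (a i)) ->
    (forall p q, Q p -> Q q -> Q (p + q)) ->
    (forall p q, Q p -> Q q -> Q (p * q)) ->
  forall p, Q p.
Proof.
move=> QC Qa; apply: mpoly_gen_ind => // i.
by have := Qa i; rewrite /a_ inord_val -ltnS ltn_ord; apply.
Qed.

(** The coefficient d - i vanishes at i = d, so the out-of-range [a d.+1] is harmless. *)
Lemma EplusE p :
  E p = der (fun i : 'I_d.+1 => (d%:R - i%:R)%:MP * a i.+1) p.
Proof.
rewrite /Eplus /der big_ord_recr /= subrr mpolyC0 !mul0r addr0.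
apply: eq_bigr => i _; rewrite natrB ?(ltnW (ltn_ord i)) // mul_mpolyC scalerAl.
by congr (_ * _^`M( _)); apply: val_inj; rewrite /= inordK // ltnS ltnW.
Qed.

Lemma EplusD p q : E (p + q) = E p + E q.
Proof. by rewrite !EplusE derD. Qed.

Lemma EplusC c : E c%:MP = 0.
Proof. by rewrite EplusE derC. Qed.

Lemma Eplus_a i : (i <= d)%N -> E (a i) = (d%:R - i%:R)%:MP * a i.+1.
Proof. by move=> le_id; rewrite EplusE derX inordK. Qed.

Lemma EplusCM c p : E (c%:MP * p) = c%:MP * E p.
Proof. by rewrite EplusM EplusC mul0r add0r. Qed.

Lemma EplusZ c p : E (c *: p) = c *: E p.
Proof. by rewrite -!mul_mpolyC EplusCM. Qed.

Lemma Eplus0 : E 0 = 0.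
Proof. by rewrite -mpolyC0 EplusC. Qed.

(** With H for [sl2_weight], an sl2-triple: [E_-, E_+] = H and [H, E_+] = -2 E_+. At i = 0 the
    coefficient i hides the truncated predecessor. *)
Definition Eminus p : P := der (fun i : 'I_d.+1 => i%:R%:MP * a i.-1) p.
Definition sl2_weight p : P :=
  der (fun i : 'I_d.+1 => (d%:R - 2 * i%:R)%:MP * 'X_i) p.

Lemma EminusD p q : Eminus (p + q) = Eminus p + Eminus q.
Proof. exact: derD. Qed.

Lemma EminusM p q : Eminus (p * q) = Eminus p * q + p * Eminus q.
Proof. exact: derM. Qed.

Lemma EminusC c : Eminus c%:MP = 0.
Proof. exact: derC. Qed.

Lemma weightD p q : sl2_weight (p + q) = sl2_weight p + sl2_weight q.
Proof. exact: derD. Qed.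

Lemma weightM p q : sl2_weight (p * q) = sl2_weight p * q + p * sl2_weight q.
Proof. exact: derM. Qed.

Lemma weightC c : sl2_weight c%:MP = 0.
Proof. exact: derC. Qed.

Lemma Eminus_a i : (i <= d)%N -> Eminus (a i) = i%:R%:MP * a i.-1.
Proof. by move=> le_id; rewrite /Eminus derX inordK. Qed.

Lemma weight_a i : (i <= d)%N -> sl2_weight (a i) = (d%:R - 2 * i%:R)%:MP * a i.
Proof. by move=> le_id; rewrite /sl2_weight derX inordK. Qed.

Lemma EminusCM c p : Eminus (c%:MP * p) = c%:MP * Eminus p.
Proof. by rewrite EminusM EminusC mul0r add0r. Qed.

Lemma weightCM c p : sl2_weight (c%:MP * p) = c%:MP * sl2_weight p.
Proof. by rewrite weightM weightC mul0r add0r. Qed.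

(** A commutator of derivations is a derivation, so generators suffice; on a_i the identity is (d -
    i)(i + 1) - i(d - i + 1) = d - 2i. *)
Lemma Eminus_Eplus p : Eminus (E p) = E (Eminus p) + sl2_weight p.
Proof.
elim/mpoly_a_ind: p => [c|i le_id|p q IHp IHq|p q IHp IHq].
- by rewrite EplusC EminusC weightC Eplus0 /Eminus der0 addr0.
- rewrite Eplus_a // Eminus_a // weight_a // EplusCM EminusCM.
  have [lt_id|] := ltnP i d.
    rewrite Eminus_a //= -natr1.
    case: i le_id lt_id => [|i] le_id lt_id /=.
      ring.
    rewrite Eplus_a 1?ltnW //=. by rewrite -natr1; ring.
  move=> le_di; have eq_di: d%:R = i%:R :> K.
    by apply/eqP; rewrite eqr_nat eqn_leq le_id andbT.
  case: i le_id eq_di {le_di} => [|i] le_id eq_di; first by rewrite eq_di; ring.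
  by rewrite Eplus_a 1?ltnW //= eq_di -natr1; ring.
- by rewrite EplusD 2!EminusD EplusD weightD IHp IHq; ring.
- by rewrite EplusM EminusD 3!EminusM EplusD 2!EplusM weightM IHp IHq; ring.
Qed.

Lemma weight_Eplus p : sl2_weight (E p) = E (sl2_weight p) - 2 * E p.
Proof.
elim/mpoly_a_ind: p => [c|i le_id|p q IHp IHq|p q IHp IHq].
- by rewrite EplusC weightC Eplus0 /sl2_weight der0; ring.
- rewrite weight_a // EplusCM Eplus_a // weightCM.
  have [lt_id|le_di] := ltnP i d; first by rewrite weight_a // -natr1; ring.
  have ->: d%:R = i%:R :> K by apply/eqP; rewrite eqr_nat eqn_leq le_id andbT.
  ring.
- by rewrite EplusD 2!weightD EplusD IHp IHq; ring.
- by rewrite EplusM weightD 3!weightM EplusD 2!EplusM IHp IHq; ring.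
Qed.

(* [E_+^k(a_0^(r/d)) = a_0^(r/d - k) cpow k]: the exponent is split off. *)
Fixpoint cpow (r k : nat) : P :=
  if k is k'.+1 then
    (r%:R - k'%:R * d%:R)%:MP * (a 1 * cpow r k') + a 0 * E (cpow r k')
  else 1.

Lemma cpowS r k : cpow r k.+1 =
  (r%:R - k%:R * d%:R)%:MP * (a 1 * cpow r k) + a 0 * E (cpow r k).
Proof. by []. Qed.

(** E_+ brings down d times the exponent r/d - n, which is the integer r - n d. *)
Lemma h0_cpow (r : nat) : (0 < d)%N -> h0 K r d = cpow r r.+1.
Proof.
move=> d_gt0.
suff iterE (n : nat) : iter n (@powexpr_Eplus K d) (a0pow K d (r%:R / d%:R))
    = (r%:R / d%:R - n%:R, cpow r n).
  by rewrite /h0 /h0_expr iterE /powexpr_mul /= mul1r.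
elim: n => [|n IHn]; first by rewrite subr0.
rewrite iterS IHn /powexpr_Eplus /=; congr pair.
  by rewrite -natr1 opprD addrA.
congr (_ + _); rewrite -mul_mpolyC; congr (_%:MP * _).
rewrite rmorphB fmorph_div /= !rmorph_nat mulrBl divfK //.
by rewrite pnatr_eq0 -lt0n.
Qed.

Hypothesis d_gt0 : (0 < d)%N.

(** Each recursion step multiplies by a_1, or applies E_+ and multiplies by a_0; both raise the
    weight by d - 2. *)
Lemma weight_cpow r k :
  sl2_weight (cpow r k) = (k%:R * (d%:R - 2))%:MP * cpow r k.
Proof.
elim: k => [|k IHk] /=.
  by rewrite mul0r mpolyC0 mul0r -mpolyC1 weightC.
rewrite weightD weightCM !weightM weight_Eplus IHk EplusCM !weight_a //.
by rewrite -natr1; ring.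
Qed.

(** The factor r - k vanishes exactly at k = r, which singles out h_0. *)
Lemma Eminus_cpow r k :
  Eminus (cpow r k.+1) = (k.+1%:R * (r%:R - k%:R))%:MP * (a 0 * cpow r k).
Proof.
elim: k => [|k IHk].
  rewrite /= -mpolyC1 EplusC mulr0 addr0 EminusCM EminusM EminusC Eminus_a //.
  by rewrite /= mpolyC1; ring.
rewrite cpowS EminusD EminusCM !EminusM Eminus_Eplus weight_cpow.
rewrite IHk EplusCM EplusM !Eminus_a // Eplus_a //= -!natr1; ring.
Qed.

Lemma Eminus_h0 r : Eminus (h0 K r d) = 0.
Proof. by rewrite h0_cpow // Eminus_cpow subrr mulr0 mpolyC0 mul0r. Qed.

Definition Eplus_nilpotent p := exists m, iter m E p = 0.

Lemma iter_EplusD m p q : iter m E (p + q) = iter m E p + iter m E q.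
Proof. by elim: m => //= m ->; rewrite EplusD. Qed.

Lemma iter_Eplus0 m : iter m E 0 = 0.
Proof. by elim: m => //= m ->; rewrite Eplus0. Qed.

Lemma iter_Eplus_le m n p : (m <= n)%N -> iter m E p = 0 -> iter n E p = 0.
Proof. by move=> /subnK <- p0; rewrite iterD p0 iter_Eplus0. Qed.

(** Induction on m + n replaces the binomial Leibniz formula: one E_+ gives two products, each with
    m or n lowered by one. *)
Lemma iter_EplusM m n p q :
  iter m E p = 0 -> iter n E q = 0 -> iter (m + n) E (p * q) = 0.
Proof.
have [k] := ubnP (m + n)%N; elim: k => // k IHk in m n p q *.
case: m => [|m] lt_mnk Ep; first by rewrite [p]Ep mul0r iter_Eplus0.
case: n => [|n] in lt_mnk * => Eq; first by rewrite [q]Eq mulr0 iter_Eplus0.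
rewrite addSn iterSr EplusM iter_EplusD.
have -> : iter (m + n.+1) E (E p * q) = 0.
  by apply: (IHk) => //; rewrite -iterSr.
rewrite add0r addnS -addSn; apply: (IHk) => //; first by rewrite -addnS.
by rewrite -iterSr.
Qed.

Lemma Eplus_locally_nilpotent p : Eplus_nilpotent p.
Proof.
elim/mpoly_a_ind: p => [c|i le_id|p q [m Ep] [n Eq]|p q [m Ep] [n Eq]].
- by exists 1%N; rewrite /= EplusC.
- have [k] := ubnP (d - i)%N; elim: k => // k IHk in i le_id *.
  case: (ltnP i d) => [lt_id|le_di] lt_k; last first.
    exists 1%N; rewrite /= Eplus_a //.
    have -> : d%:R = i%:R :> K by apply/eqP; rewrite eqr_nat eqn_leq le_id andbT.
    by rewrite subrr mpolyC0 mul0r.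
  have [|m Em] := IHk i.+1 lt_id; first by rewrite subnS prednK ?subn_gt0.
  exists (1 + m).+1%N; rewrite iterSr Eplus_a //.
  by apply: (iter_EplusM (m := 1)) => //; apply: EplusC.
- exists (m + n)%N; rewrite iter_EplusD (iter_Eplus_le (leq_addr _ _) Ep).
  by rewrite (iter_Eplus_le (leq_addl _ _) Eq) addr0.
- by exists (m + n)%N; apply: iter_EplusM.
Qed.

Lemma weight_iter n p k : sl2_weight p = n%:R%:MP * p ->
  sl2_weight (iter k E p) = (n%:R - 2 * k%:R)%:MP * iter k E p.
Proof.
move=> wp; elim: k => [|k IHk]; first by rewrite /= wp; ring.
by rewrite iterS weight_Eplus IHk EplusCM -natr1; ring.
Qed.

(** Moving E_- past k + 1 copies of E_+ collects the weights n - 2j for j <= k, with sum (k + 1)(n -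
    k). *)
Lemma Eminus_iter n p k : sl2_weight p = n%:R%:MP * p -> Eminus p = 0 ->
  Eminus (iter k.+1 E p) = (k.+1%:R * (n%:R - k%:R))%:MP * iter k E p.
Proof.
move=> wp mp; elim: k => [|k IHk].
  by rewrite /= Eminus_Eplus mp wp Eplus0; ring.
rewrite iterS Eminus_Eplus IHk EplusCM (weight_iter _ wp) -iterS -!natr1.
ring.
Qed.

(* A lowest weight vector on which [E] is nilpotent generates a finite
   dimensional sl2-module. *)
Lemma iter_Eplus_lowest n p : sl2_weight p = n%:R%:MP * p -> Eminus p = 0 ->
  iter n.+1 E p = 0.
Proof.
move=> wp mp; have [m] := Eplus_locally_nilpotent p.
elim: m => [|m IHm] Ep0; first by apply: (iter_Eplus_le (leq0n _) Ep0).
have [lt_nm|le_mn] := ltnP n m; last exact: iter_Eplus_le Ep0.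
(* Applying E_- to E_+^(m+1) p = 0 gives (m + 1)(n - m) E_+^m p = 0, whose factor is nonzero since n
   < m. *)
apply: IHm; have := Eminus_iter m wp mp; rewrite Ep0 /Eminus der0.
move=> /esym/eqP.
rewrite mulf_eq0 mpolyC_eq0 mulf_eq0 pnatr_eq0 /= subr_eq0 eqr_nat.
by rewrite (ltn_eqF lt_nm) => /eqP.
Qed.

End Sl2.

(** * Generalities on ideals *)

Section IdealTheory.
Variable A : comNzRingType.
Implicit Types (I S : A -> Prop) (f g q : A).

Definition is_ideal I := [/\ I 0, forall f g, I f -> I g -> I (f + g)
                           & forall q f, I f -> I (q * f)].

Lemma ideal_gen_is_ideal S : is_ideal (ideal_gen S).
Proof.
split=> [|f1 f2 [n1 [q1 [g1 [Sg1 ->]]]] [n2 [q2 [g2 [Sg2 ->]]]]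
  |q f [n [q1 [g [Sg ->]]]]].
- by exists 0%N, (fun=> 0), (fun=> 0); split; [case | rewrite big_ord0].
- exists (n1 + n2)%N,
    (fun i => match split i with inl j => q1 j | inr j => q2 j end),
    (fun i => match split i with inl j => g1 j | inr j => g2 j end).
  split=> [i|]; first by case: (split i).
  rewrite big_split_ord; congr (_ + _); apply: eq_bigr => i _ /=.
    by rewrite (unsplitK (inl i)).
  by rewrite (unsplitK (inr i)).
- exists n, (fun i => q * q1 i), g; split=> //.
  by rewrite mulr_sumr; apply: eq_bigr => i _; rewrite mulrA.
Qed.

Lemma ideal_gen_mem S f : S f -> ideal_gen S f.
Proof.
by exists 1%N, (fun=> 1), (fun=> f); split=> //; rewrite big_ord1 mul1r.
Qed.

Lemma ideal_sum I n (F : 'I_n -> A) :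
  is_ideal I -> (forall i, I (F i)) -> I (\sum_i F i).
Proof. by case=> I0 ID _ IF; apply: (big_ind I). Qed.

Lemma ideal_opp I f : is_ideal I -> I f -> I (- f).
Proof. by case=> _ _ IM If; rewrite -mulN1r; apply: IM. Qed.

Lemma ideal_pow_expr I n f : I f -> ideal_pow I n (f ^+ n).
Proof.
move=> If; elim: n => //= n IHn; apply: ideal_gen_mem.
by exists (f ^+ n), f; rewrite exprSr.
Qed.

End IdealTheory.

(** * Elimination of a_(r+1), ..., a_d where a_0 is inverted *)

Section A0Saturation.
Variables (K : numFieldType) (r d : nat).
Hypotheses (r_gt0 : (0 < r)%N) (d_gt1 : (1 < d)%N).
Local Notation P := {mpoly K[d.+1]}.
Local Notation a := (a_ K d).
Local Notation E := (@Eplus K d).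
Local Notation J := (@hilbert_ideal K r d).
Local Notation c := (cpow K d r).
Implicit Types f g p q : P.

Let d_gt0 : (0 < d)%N. Proof. exact: ltnW. Qed.

Lemma hilbert_ideal_is_ideal : is_ideal J.
Proof. exact: ideal_gen_is_ideal. Qed.
Let J0 : J 0. Proof. by case: hilbert_ideal_is_ideal. Qed.
Let JD f g : J f -> J g -> J (f + g).
Proof. by case: hilbert_ideal_is_ideal => _ + _; apply. Qed.
Let JM q f : J f -> J (q * f).
Proof. by case: hilbert_ideal_is_ideal => _ _; apply. Qed.
Let JB f g : J f -> J g -> J (f - g).
Proof. by move=> Jf /(ideal_opp hilbert_ideal_is_ideal); apply: JD. Qed.

(** Up to k = N this is a nonzero multiple of h_k; beyond N it is zero, as h_0 has weight N and is
    killed by E_-. *)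
Lemma hilbert_ideal_iter_h0 k : J (iter k E (h0 K r d)).
Proof.
have [le_kN|lt_Nk] := leqP k (covariant_order r d).
  suff -> : iter k E (h0 K r d) =
      ((covariant_order r d)`!%:R / (covariant_order r d - k)`!%:R)%:MP
        * h_ K r d k.
    by apply/JM/ideal_gen_mem; exists k.
  rewrite /h_ -mul_mpolyC mulrA -mpolyCM mulf_div [X in X / _]mulrC divff.
    by rewrite mpolyC1 mul1r.
  by rewrite mulf_neq0 // pnatr_eq0 -lt0n fact_gt0.
rewrite (iter_Eplus_le lt_Nk) // iter_Eplus_lowest ?Eminus_h0 //.
by rewrite h0_cpow // weight_cpow // /covariant_order natrM natrB.
Qed.

Lemma hilbert_ideal_Eplus f : J f -> J (E f).
Proof.
case=> n [q [g [Sg ->]]].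
elim/big_ind: _ => [|u v JEu JEv|i _]; first by rewrite Eplus0.
  by rewrite EplusD; apply: JD.
rewrite EplusM; apply: JD; apply: JM; first exact/ideal_gen_mem/Sg.
have [k _ ->] := Sg i; rewrite /h_ EplusZ -iterS -mul_mpolyC.
exact/JM/hilbert_ideal_iter_h0.
Qed.

(** The contraction to R of the extension of J to R[1/a_0]. *)
Definition a0_sat f := exists n, J (a 0 ^+ n * f).

Lemma a0_satM q f : a0_sat f -> a0_sat (q * f).
Proof. by case=> n Jf; exists n; rewrite mulrCA; apply: JM. Qed.

Lemma a0_satD f g : a0_sat f -> a0_sat g -> a0_sat (f + g).
Proof.
case=> m Jf [n Jg]; exists (m + n)%N; rewrite mulrDr; apply: JD.
  by rewrite exprD mulrAC mulrC; apply: JM.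
by rewrite exprD -mulrA; apply: JM.
Qed.

Lemma a0_sat_Eplus f : a0_sat f -> a0_sat (E f).
Proof.
case=> n Jf; exists n.+1.
have JEf := JM (a 0) (hilbert_ideal_Eplus Jf).
have EX : a 0 * E (a 0 ^+ n) = n%:R * (a 0 ^+ n * E (a 0)).
  elim: n {Jf JEf} => [|n IHn]; first by rewrite -mpolyC1 EplusC; ring.
  by rewrite exprS EplusM mulrDr mulrCA [a 0 * (a 0 * _)]mulrCA IHn -natr1; ring.
(* The product rule; the extra factor a_0 makes up for the exponent lost when E_+ hits a_0^n. *)
have -> : a 0 ^+ n.+1 * E f
  = a 0 * E (a 0 ^+ n * f) - n%:R * E (a 0) * (a 0 ^+ n * f).
  by rewrite EplusM mulrDr mulrA EX exprS; ring.
by apply: JB => //; apply: JM.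
Qed.

Lemma a0_sat_cpow k : (r < k)%N -> a0_sat (c k).
Proof.
elim: k => // k IHk; rewrite ltnS leq_eqVlt => /orP[/eqP<-|lt_rk].
  by exists 0%N; rewrite mul1r -h0_cpow //; apply: (hilbert_ideal_iter_h0 0).
rewrite cpowS; apply: a0_satD.
  by rewrite mulrA; apply/a0_satM/IHk.
by apply/a0_satM/a0_sat_Eplus/IHk.
Qed.

(** The subalgebra K[a_0, ..., a_k]. *)
Inductive alg_upto (k : nat) : P -> Prop :=
| alg_const x : alg_upto k x%:MP
| alg_var i : (i <= k)%N -> alg_upto k (a i)
| alg_add f g : alg_upto k f -> alg_upto k g -> alg_upto k (f + g)
| alg_mul f g : alg_upto k f -> alg_upto k g -> alg_upto k (f * g).

Lemma alg_upto_exp k f n : alg_upto k f -> alg_upto k (f ^+ n).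
Proof.
move=> fk; elim: n => [|n IHn]; first by rewrite expr0 -mpolyC1; apply: alg_const.
by rewrite exprS; apply: alg_mul.
Qed.

Lemma alg_upto_Eplus k f : (k < d)%N -> alg_upto k f -> alg_upto k.+1 (E f).
Proof.
move=> lt_kd.
suff: alg_upto k f -> alg_upto k.+1 f /\ alg_upto k.+1 (E f) by move=> h /h[].
elim=> [x|i le_ik|{}f g _ [f1 f2] _ [g1 g2]|{}f g _ [f1 f2] _ [g1 g2]].
- by rewrite EplusC -mpolyC0; split; apply: alg_const.
- rewrite Eplus_a; last exact: leq_trans le_ik (ltnW lt_kd).
  split; first by apply: alg_var; apply: leqW.
  by apply: alg_mul; [apply: alg_const | apply: alg_var].
- by rewrite EplusD; split; apply: alg_add.
- by rewrite EplusM; split; [|apply: alg_add]; apply: alg_mul.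
Qed.

Lemma alg_upto_le k l f : (k <= l)%N -> alg_upto k f -> alg_upto l f.
Proof.
move=> le_kl; elim=> [x|i le_ik|{}f g _ f1 _ g1|{}f g _ f1 _ g1].
- exact: alg_const.
- by apply: alg_var; apply: leq_trans le_kl.
- exact: alg_add.
- exact: alg_mul.
Qed.

(** Only E_+ acting on the last variable of the leading term brings in a new one, so x = r(d -
    1)...(d - k). Where a_0 is invertible, c_(k+1) can thus replace a_(k+1) as a coordinate. *)
Lemma cpow_lead k : (k < d)%N -> exists2 x : K, x != 0 &
  exists2 q, alg_upto k q & c k.+1 = x%:MP * (a 0 ^+ k * a k.+1) + q.
Proof.
elim: k => [|k IHk] lt_kd.
  exists r%:R; first by rewrite pnatr_eq0 -lt0n.
  exists 0; first by rewrite -mpolyC0; apply: alg_const.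
  by rewrite cpowS /= -mpolyC1 EplusC; ring.
have [x x_neq0 [q qk ck]] := IHk (ltnW lt_kd).
exists (x * (d%:R - k.+1%:R)).
  by rewrite mulf_neq0 // subr_eq0 eqr_nat gtn_eqF.
exists ((r%:R - k.+1%:R * d%:R)%:MP * (a 1 * c k.+1)
    + a 0 * (x%:MP * (E (a 0 ^+ k) * a k.+1) + E q)).
  have ak1 i : (i <= k.+1)%N -> alg_upto k.+1 (a i) by apply: alg_var.
  apply: alg_add; first apply: alg_mul; first exact: alg_const.
    apply: alg_mul; first exact: ak1.
    rewrite ck; apply: alg_add; last exact: alg_upto_le qk.
    apply: alg_mul; first exact: alg_const.
    by apply: alg_mul; [apply: alg_upto_exp|]; apply: ak1.
  apply: alg_mul; first exact: ak1.
  apply: alg_add; last by apply: alg_upto_Eplus qk; apply: ltnW.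
  apply: alg_mul; first exact: alg_const.
  apply: alg_mul; last exact: ak1.
  apply: alg_upto_Eplus; first exact: ltnW.
  by apply/alg_upto_exp/alg_var.
rewrite cpowS {2}ck EplusD EplusCM EplusM Eplus_a 1?ltnW // exprS; ring.
Qed.

(** Says, without building the localization, that f lies in K[a_0, ..., a_r, 1/a_0] modulo the
    extension of J to R[1/a_0]. *)
Definition a0_reducible f :=
  exists n, exists2 g, alg_upto r g & a0_sat (a 0 ^+ n * f - g).

Lemma a0_reducible_alg f : alg_upto r f -> a0_reducible f.
Proof.
move=> fr; exists 0%N, f => //; rewrite mul1r subrr.
by exists 0%N; rewrite mulr0.
Qed.

Lemma alg_upto_a0 : alg_upto r (a 0). Proof. exact: alg_var. Qed.

Lemma a0_reducibleD f g : a0_reducible f -> a0_reducible g -> a0_reducible (f + g).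
Proof.
case=> m [f1 f1r Vf] [n [g1 g1r Vg]].
exists (m + n)%N, (a 0 ^+ n * f1 + a 0 ^+ m * g1).
  by apply: alg_add; apply: alg_mul => //; apply/alg_upto_exp/alg_upto_a0.
have -> : a 0 ^+ (m + n) * (f + g) - (a 0 ^+ n * f1 + a 0 ^+ m * g1)
  = a 0 ^+ n * (a 0 ^+ m * f - f1) + a 0 ^+ m * (a 0 ^+ n * g - g1).
  by rewrite exprD; ring.
by apply: a0_satD; apply: a0_satM.
Qed.

Lemma a0_reducibleM f g : a0_reducible f -> a0_reducible g -> a0_reducible (f * g).
Proof.
case=> m [f1 f1r Vf] [n [g1 g1r Vg]].
exists (m + n)%N, (f1 * g1); first exact: alg_mul.
have -> : a 0 ^+ (m + n) * (f * g) - f1 * g1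
  = a 0 ^+ n * g * (a 0 ^+ m * f - f1) + f1 * (a 0 ^+ n * g - g1).
  by rewrite exprD; ring.
by apply: a0_satD; apply: a0_satM.
Qed.

Lemma a0_reducible_a0X n f : a0_reducible (a 0 ^+ n * f) -> a0_reducible f.
Proof. by case=> m [g gr Vf]; exists (m + n)%N, g => //; rewrite exprD -mulrA. Qed.

Lemma a0_reducible_alg_upto k f :
  (forall i, (i <= k)%N -> a0_reducible (a i)) -> alg_upto k f -> a0_reducible f.
Proof.
move=> red_a; elim=> [x|i|{}f g _ + _|{}f g _ + _].
- by apply/a0_reducible_alg/alg_const.
- exact: red_a.
- exact: a0_reducibleD.
- exact: a0_reducibleM.
Qed.

Lemma a0_reducible_a i : (i <= d)%N -> a0_reducible (a i).
Proof.
have [k] := ubnP i; elim: k => // k IHk in i *; move=> lt_ik le_id.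
have [le_ir|lt_ri] := leqP i r; first exact/a0_reducible_alg/alg_var.
case: i => // i in lt_ik le_id lt_ri *.
have [x x_neq0 [q qi ci]] := cpow_lead le_id.
apply: (@a0_reducible_a0X i).
(* Modulo [a0_sat], c_(i+1) is zero, so a_0^i a_(i+1) is congruent to -q/x, and q involves only
   earlier variables. *)
have [n [g gr Vq]] : a0_reducible ((- x^-1)%:MP * q).
  apply: a0_reducibleM; first exact/a0_reducible_alg/alg_const.
  apply: a0_reducible_alg_upto qi => j le_ji; apply: IHk.
    exact: leq_ltn_trans le_ji lt_ik.
  exact: leq_trans le_ji (ltnW le_id).
exists n, g => //.
have -> : a 0 ^+ n * (a 0 ^+ i * a i.+1) - g
    = (a 0 ^+ n * (x^-1)%:MP) * c i.+1 + (a 0 ^+ n * ((- x^-1)%:MP * q) - g).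
  rewrite ci mulrDr [_ * (x%:MP * _)]mulrA -[_ * _ * x%:MP]mulrA -mpolyCM.
  rewrite mulVf // mpolyC1; ring.
by apply: a0_satD => //; apply: a0_satM; apply: a0_sat_cpow.
Qed.

Lemma a0_reducible_all f : a0_reducible f.
Proof.
elim/mpoly_a_ind: f => [x|i|f g|f g].
- by apply/a0_reducible_alg/alg_const.
- exact: a0_reducible_a.
- exact: a0_reducibleD.
- exact: a0_reducibleM.
Qed.

End A0Saturation.

(** * Powers of the irrelevant ideal *)

Lemma ideal_pow_mdeg (n : nat) (R : comNzRingType) M (g : {mpoly R[n]}) :
  ideal_pow (ideal_gen (fun f => exists i : 'I_n, f = 'X_i)) M g ->
  {in msupp g, forall m, (M <= mdeg m)%N}.
Proof.
pose low M (g : {mpoly R[n]}) := {in msupp g, forall m, (M <= mdeg m)%N}.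
have lowD k (f1 f2 : {mpoly R[n]}) : low k f1 -> low k f2 -> low k (f1 + f2).
  move=> l1 l2 m /msuppD_le; rewrite mem_cat => /orP[]; [exact: l1|exact: l2].
have low0 k : low k 0 by move=> m; rewrite msupp0.
have lowM k l f1 f2 : low k f1 -> low l f2 -> low (k + l)%N (f1 * f2).
  move=> l1 l2 m /msuppM_le/allpairsP[[m1 m2] /= [m1f m2f ->]].
  by rewrite mdegD leq_add ?l1 ?l2.
rewrite -/(low M g); elim: M g => [|M IHM] g /=; first by move=> _ m.
case=> k [q [h [Sh ->]]]; apply: (big_ind (low M.+1)) => // [|i _].
  exact: lowD.
have [u [v [uM vI ->]]] := Sh i.
rewrite -[M.+1]add0n; apply: (lowM) => //.
rewrite -addn1; apply: (lowM).
  exact: IHM.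
have [l [s [x [Sx ->]]]] := vI; apply: (big_ind (low 1%N)) => // [|j _].
  exact: lowD.
rewrite -[1%N]add0n; apply: (lowM) => //; have [t ->] := Sx j.
by move=> m; rewrite msuppX inE => /eqP->; rewrite mdeg1.
Qed.

Lemma ideal_pow_sub (n : nat) (R : comNzRingType) (I : {mpoly R[n]} -> Prop) :
  is_ideal I -> (forall i, exists k, I ('X_i ^+ k)) ->
  exists M, forall g, ideal_pow (ideal_gen (fun f => exists i : 'I_n, f = 'X_i)) M g
    -> I g.
Proof.
move=> idI; have [I0 ID IM] := idI => IX.
have [k Ik] : exists k, forall i : 'I_n, I ('X_i ^+ k).
  suff [k Ik] : exists k, forall i, i \in enum 'I_n -> I ('X_i ^+ k).
    by exists k => i; apply: Ik; rewrite mem_enum.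
  elim: (enum 'I_n) => [|j s [k Ik]]; first by exists 0%N.
  have [l Il] := IX j; exists (l + k)%N => i; rewrite inE exprD.
  by case/orP => [/eqP->|/Ik]; [rewrite mulrC|]; apply: IM.
(* Pigeonhole: a monomial of degree above n k in n variables is divisible by some X_i^k. *)
exists (n * k).+1 => g /ideal_pow_mdeg gM.
rewrite [g]mpolyE big_seq; apply: (big_ind I) => // m /gM lt_nkm.
rewrite -mul_mpolyC; apply: (IM).
have [i le_ki] : exists i, (k <= m i)%N.
  case: (pickP (fun i => k <= m i)%N) => [i|no]; first by exists i.
  have : (mdeg m <= n * k)%N.
    rewrite mdegE -[n in (n * k)%N]card_ord -sum_nat_const.
    by apply: leq_sum => i _; rewrite leqNgt; apply/negP => /ltnW; rewrite no.
  by rewrite leqNgt lt_nkm.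
rewrite mpolyXE_id (bigD1 i) //= mulrC -(subnK le_ki) exprD mulrA.
exact: IM.
Qed.

(** * Radicals of E_+-stable ideals *)

Section Radical.
Variables (K : numFieldType) (d : nat).
Local Notation P := {mpoly K[d.+1]}.
Local Notation a := (a_ K d).
Local Notation E := (@Eplus K d).
Implicit Types f g : P.

(** The extra factor f avoids the truncated exponent n - 1. *)
Lemma EplusXn f n : f * E (f ^+ n) = n%:R * (f ^+ n * E f).
Proof.
elim: n => [|n IHn]; first by rewrite expr0 -mpolyC1 EplusC; ring.
by rewrite exprS EplusM mulrDr [f * (f * _)]mulrCA IHn -natr1; ring.
Qed.

Variable I : P -> Prop.
Hypotheses (idI : is_ideal I) (I_Eplus : forall f, I f -> I (E f)).

(* Ritt: in characteristic zero the radical of a differential ideal is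
   differential. *)
Lemma radical_Eplus g n : I (g ^+ n) -> I (E g ^+ n.*2).
Proof.
have [I0 ID IM] := idI.
(* Each pass trades one factor g for two factors E g: differentiate, multiply by E g, remove the E(E
   g) term, and divide by the exponent of g. *)
suff step k j : I (g ^+ k * E g ^+ j) -> I (E g ^+ (k.*2 + j)).
  by move=> Ign; rewrite -[n.*2]addn0; apply: step; rewrite mulr1.
elim: k j => [|k IHk] j; first by rewrite mul1r.
move=> Igj; rewrite doubleS !addSn -!addnS; apply: IHk.
have -> : g ^+ k * E g ^+ j.+2 = (k.+1%:R^-1)%:MP * (E g *
    E (g ^+ k.+1 * E g ^+ j) - j%:R * E (E g) * (g ^+ k.+1 * E g ^+ j)).
  have Egk : E (g ^+ k.+1) = k.+1%:R%:MP * (g ^+ k * E g).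
    elim: (k) => [|l IHl]; first by rewrite expr1 expr0 mpolyC1; ring.
    by rewrite exprS EplusM IHl -[l.+2%:R]natr1 exprS; ring.
  rewrite EplusM Egk [E g * _]mulrDr [E g * (g ^+ k.+1 * _)]mulrCA EplusXn.
  transitivity ((k.+1%:R^-1 * k.+1%:R)%:MP * (g ^+ k * E g ^+ j.+2)).
    by rewrite mulVf ?pnatr_eq0 // mpolyC1 mul1r.
  by rewrite mpolyCM !exprS; ring.
apply: (IM); apply: ID; first exact/IM/I_Eplus.
exact/(ideal_opp idI)/IM.
Qed.

(** For i < d, E_+ a_i is a nonzero multiple of a_(i+1), so one moves up variable by variable,
    doubling the exponent. *)
Lemma radical_a_exp n i : I (a 0 ^+ n) -> (i <= d)%N -> exists m, I (a i ^+ m).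
Proof.
have [I0 ID IM] := idI.
move=> I_a0; elim: i => [|i IHi] lt_id; first by exists n.
have [m Im] := IHi (ltnW lt_id); exists m.*2.
have := radical_Eplus Im; rewrite Eplus_a 1?ltnW // exprMn -rmorphXn => Iam.
have cd_neq0 : (d%:R - i%:R : K) ^+ m.*2 != 0.
  by rewrite expf_neq0 // subr_eq0 eqr_nat gtn_eqF.
rewrite -[_ ^+ _]mul1r -mpolyC1 -(mulVf cd_neq0) mpolyCM -mulrA.
exact: IM.
Qed.

End Radical.

(** * From powers of a_0 to the irrelevant ideal *)

Section SaturationFromA0.
Variables (K : numFieldType) (r d : nat).
Hypotheses (r_gt0 : (0 < r)%N) (d_gt1 : (1 < d)%N).
Local Notation P := {mpoly K[d.+1]}.
Local Notation a := (a_ K d).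
Local Notation E := (@Eplus K d).
Local Notation J := (@hilbert_ideal K r d).
Implicit Types f g : P.

Lemma saturation_a0_sat f : a0_sat r f -> saturation J (@irrelevant_ideal K d) f.
Proof.
have [J0 JD JM] := @hilbert_ideal_is_ideal K r d.
move=> Vf; have Vk k : a0_sat r (iter k E f).
  by elim: k => //= k; apply: a0_sat_Eplus.
have [m Em0] := Eplus_locally_nilpotent f.
(* Only finitely many E_+^k f are nonzero, so one exponent serves them all. *)
have [n Jn] : exists n, forall k, J (a 0 ^+ n * iter k E f).
  suff [n Jn] : exists n, forall k, (k < m)%N -> J (a 0 ^+ n * iter k E f).
    exists n => k; have [|le_mk] := ltnP k m; first exact: Jn.
    by rewrite (iter_Eplus_le le_mk Em0) mulr0.
  elim: (m) => [|l [n Jn]]; first by exists 0%N.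
  have [n' Jn'] := Vk l; exists (n + n')%N => k; rewrite ltnS leq_eqVlt exprD.
  case/orP => [/eqP->|/Jn Jk]; first by rewrite -mulrA; apply: JM.
  by rewrite [_ ^+ n * _]mulrC -mulrA; apply: JM.
pose I g := forall k, J (g * iter k E f).
have idI : is_ideal I.
  split=> [k|g h Ig Ih k|q g Ig k].
  - by rewrite mul0r.
  - by rewrite mulrDl; apply: JD.
  - by rewrite -mulrA; apply: JM.
have IE g : I g -> I (E g).
  move=> Ig k; have -> : E g * iter k E f =
      E (g * iter k E f) - g * iter k.+1 E f by rewrite EplusM addrK.
  apply: JD; first exact: hilbert_ideal_Eplus.
  exact/(ideal_opp (@hilbert_ideal_is_ideal K r d)).
have [|M IM] := ideal_pow_sub idI.
  move=> i; have := @radical_a_exp K d I idI IE n i Jn (ltn_ord i).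
  by rewrite /a_ inord_val.
by exists M => g /IM Ig; apply: (Ig 0%N).
Qed.

End SaturationFromA0.

(** * Polynomials vanishing at all points *)

Section Vanishing.
Variable K : numFieldType.

Lemma poly_vanish (p : {poly K}) : (forall x, x != 0 -> p.[x] = 0) -> p = 0.
Proof.
move=> p0; apply/eqP; apply: contraT => p_neq0.
pose s : seq K := [seq k.+1%:R | k <- iota 0 (size p)].
have := @max_poly_roots _ p s p_neq0; rewrite size_map size_iota ltnn; apply.
  by apply/allP => x /mapP[k _ ->]; rewrite rootE p0 ?pnatr_eq0.
rewrite map_inj_uniq ?iota_uniq // => k l /eqP.
by rewrite eqr_nat eqSS => /eqP.
Qed.

(** Restriction to the line through v in direction i turns the partial derivative into an ordinary
    one, and the restriction of p is the zero polynomial. *)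
Lemma mderiv_vanish n (p : {mpoly K[n]}) i :
  (forall v, p.@[v] = 0) -> forall v, p^`M(i).@[v] = 0.
Proof.
move=> p0 v.
pose h (j : 'I_n) : {poly K} := (v j)%:P + (i == j)%:R *: 'X.
pose line := mmap (@polyC K) h.
have line_eval q x : (line q).[x] = q.@[fun j => v j + (i == j)%:R * x].
  elim/mpoly_gen_ind: q => [c|j|q1 q2 IH1 IH2|q1 q2 IH1 IH2].
  - by rewrite /line mmapC hornerC mevalC.
  - by rewrite /line mmapX mmap1U mevalXU !hornerE.
  - by rewrite /line mmapD hornerD mevalD IH1 IH2.
  - by rewrite /line rmorphM hornerM mevalM IH1 IH2.
have line_deriv q : (line q)^`() = line q^`M(i).
  elim/mpoly_gen_ind: q => [c|j|q1 q2 IH1 IH2|q1 q2 IH1 IH2].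
  - by rewrite /line mmapC derivC mderivC mmap0.
  - rewrite /line mderivX mnm1E mmapX mmap1U mmapZ mmapX /h derivD derivC.
    rewrite derivZ derivX add0r eq_sym; case: eqP => [->|_].
      by rewrite -[X in (X - _)%MM]add0m addmK mmap11 scale1r mul1r.
    by rewrite scale0r mul0r.
  - by rewrite /line mmapD derivD mderivD mmapD IH1 IH2.
  - by rewrite /line rmorphM derivM mderivM mmapD !rmorphM IH1 IH2.
have line_p0 : line p = 0 by apply: poly_vanish => x _; rewrite line_eval p0.
have := line_eval p^`M(i) 0; rewrite -line_deriv line_p0 derivC horner0 => ->.
by apply: meval_eq => j; rewrite mulr0 addr0.
Qed.

Lemma meval_fun0 n (p : {mpoly K[n]}) : p.@[fun=> 0] = p@_0%MM.
Proof.
elim/mpoly_gen_ind: p => [c|i|p q IHp IHq|p q IHp IHq].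
- by rewrite mevalC mcoeffC eqxx mulr1.
- by rewrite mevalXU mcoeffX mnm1_eq0.
- by rewrite mevalD mcoeffD IHp IHq.
- by rewrite mevalM rmorphM /= IHp IHq.
Qed.

(** The constant coefficient is the value at 0; any other is, up to a positive integer, a
    coefficient of lower degree of a partial derivative. *)
Lemma mpoly_vanish n (p : {mpoly K[n]}) : (forall v, p.@[v] = 0) -> p = 0.
Proof.
move=> p0; apply/mpolyP => m; rewrite mcoeff0.
have [k] := ubnP (mdeg m); elim: k => // k IHk in p p0 m *; rewrite ltnS => le_mk.
have [->|m_neq0] := eqVneq m 0%MM; first by rewrite -meval_fun0.
have [i mi] : exists i, m i != 0%N.
  apply/existsP; rewrite -negb_forall; apply: contra m_neq0 => /forallP m0.
  by apply/eqP/mnmP => i; rewrite mnm0E; apply/eqP.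
have le_im : (U_(i) <= m)%MM.
  by apply/mnm_lepP => j; rewrite mnm1E; case: eqP => // <-; rewrite lt0n.
have lt_imk : (mdeg (m - U_(i))%MM < k)%N.
  by rewrite -[m in mdeg m](submK le_im) mdegD mdeg1 addn1 in le_mk.
have := IHk _ (mderiv_vanish i p0) _ lt_imk; rewrite mcoeff_mderiv submK //.
by move/eqP; rewrite mulrn_eq0 /= => /eqP.
Qed.

End Vanishing.

(** * E_+ as differentiation of one-variable polynomials *)

Section Flow.
Variables (K : numFieldType) (d : nat).
Local Notation P := {mpoly K[d.+1]}.
Local Notation a := (a_ K d).
Local Notation E := (@Eplus K d).

(* For [f] of degree at most [d], [flow f] sends [a_0] to [f] and
   intertwines [E_+] with differentiation. *)
Definition flow (f : {poly K}) : P -> {poly K} :=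
  mmap (@polyC K) (fun i : 'I_d.+1 => ((d - i)`!%:R / d`!%:R) *: f^`(i)).

Implicit Types (f g : {poly K}) (p q : P).

Lemma flowC f x : flow f x%:MP = x%:P.
Proof. exact: mmapC. Qed.

Lemma flowD f p q : flow f (p + q) = flow f p + flow f q.
Proof. exact: mmapD. Qed.

Lemma flowM f p q : flow f (p * q) = flow f p * flow f q.
Proof. exact: rmorphM. Qed.

Lemma flow_a f i : (i <= d)%N ->
  flow f (a i) = ((d - i)`!%:R / d`!%:R) *: f^`(i).
Proof. by move=> le_id; rewrite /flow mmapX mmap1U inordK. Qed.

Lemma flow_a0 f : flow f (a 0) = f.
Proof. by rewrite flow_a // subn0 divff ?scale1r // pnatr_eq0 -lt0n fact_gt0. Qed.

Lemma flow_a1 f : (0 < d)%N -> d%:R%:P * flow f (a 1) = f^`().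
Proof.
move=> d_gt0; rewrite flow_a // mul_polyC scalerA subn1 mulrA -natrM.
rewrite -{1}(prednK d_gt0) -factS prednK // divff ?scale1r //.
by rewrite pnatr_eq0 -lt0n fact_gt0.
Qed.

(** The factor (d - i)!/d! absorbs the coefficient d - i of E_+. At i = d both sides vanish because
    f has degree at most d. *)
Lemma flow_Eplus f p : (size f <= d.+1)%N -> flow f (E p) = (flow f p)^`().
Proof.
move=> szf; elim/mpoly_a_ind: p => [x|i le_id|p q IHp IHq|p q IHp IHq].
- by rewrite EplusC flowC derivC /flow mmap0.
- rewrite Eplus_a // flowM flowC (flow_a f le_id) derivZ -derivnS.
  have [lt_id|le_di] := ltnP i d.
    rewrite flow_a // mul_polyC scalerA -natrB ?(ltnW lt_id) // mulrA -natrM.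
    by rewrite -[in RHS](subnSK lt_id) factS subnSK.
  have eq_id : i = d by apply/eqP; rewrite eqn_leq le_id.
  rewrite [in LHS]eq_id subrr mul0r derivn_poly0 ?scaler0 //.
  exact: leq_trans szf _.
- by rewrite EplusD !flowD derivD IHp IHq.
- by rewrite EplusM flowD !flowM derivM IHp IHq.
Qed.

Lemma flow_iter f p k : (size f <= d.+1)%N ->
  flow f (iter k E p) = (flow f p)^`(k).
Proof.
by move=> szf; elim: k => // k IHk; rewrite iterS flow_Eplus // IHk derivnS.
Qed.

(* [flow f] sends [cpow r k] to [f^(k - 1/mu) (f^(1/mu))^(k)]. *)
Lemma flow_cpow r mu x g k : (0 < mu)%N -> (0 < d)%N -> (r * mu)%N = d ->
  let f := x *: g ^+ mu in (size f <= d.+1)%N ->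
  g * flow f (cpow K d r k) = f ^+ k * g^`(k).
Proof.
move=> mu_gt0 d_gt0 rmu f szf; elim: k => [|k IHk].
  by rewrite /= -mpolyC1 flowC; ring.
rewrite cpowS flowD flowM flowC !flowM flow_Eplus // flow_a0.
set A := flow f (a 1); set y := flow f _ in IHk *.
have df : f^`() = (r * mu)%:R * A.
  by rewrite -(flow_a1 f d_gt0) rmu polyC_natr.
have mu_neq0 : mu%:R != 0 :> {poly K}.
  by rewrite -polyC_natr polyC_eq0 pnatr_eq0 -lt0n.
(* The logarithmic derivative of f = x g^mu, cleared of denominators and divided by mu. *)
have fg : r%:R * A * g = f * g^`().
  apply: (mulfI mu_neq0); rewrite !mulrA -natrM mulnC -df.
  rewrite /f derivZ deriv_exp -!mul_polyC -[in g ^+ mu](prednK mu_gt0) exprS.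
  by rewrite -mulr_natl; ring.
have dy := congr1 (@deriv K) IHk; rewrite !derivM deriv_exp -derivnS df in dy.
(* Regrouped so that the derivative of the induction hypothesis appears, with a remainder that [fg]
   kills. *)
have -> : g * ((r%:R - k%:R * d%:R)%:P * (A * y) + f * y^`()) =
  f * (g^`() * y + g * y^`()) - k%:R * (r * mu)%:R * A * (g * y)
   + (r%:R * A * g - f * g^`()) * y.
  by rewrite rmu; ring.
rewrite fg subrr mul0r addr0 dy IHk -mulr_natl.
by case: k {IHk y dy} => [|k] /=; rewrite ?exprS; ring.
Qed.

End Flow.

(** * Binary forms, the points of X and truncated roots *)

Section Forms.
Variable K : numFieldType.

Definition form_poly n (c : 'I_n.+1 -> K) : {poly K} :=
  \poly_(i < n.+1) ('C(n, i)%:R * c (inord i)).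

Definition dehom (F : {mpoly K[2]}) : {poly K} :=
  mmap (@polyC K) (fun i : 'I_2 => if i == ord0 then 1 else 'X) F.

Lemma bin_neq0 n i : (i <= n)%N -> 'C(n, i)%:R != 0 :> K.
Proof. by move=> le_in; rewrite pnatr_eq0 -lt0n bin_gt0. Qed.

Lemma form_poly_inj n (c e : 'I_n.+1 -> K) :
  form_poly c = form_poly e -> c =1 e.
Proof.
move=> /polyP eq_ce i; have := eq_ce i.
rewrite !coef_poly ltn_ord inord_val; apply: mulfI.
by rewrite bin_neq0 // -ltnS.
Qed.

Lemma form_poly_surj n (g : {poly K}) : (size g <= n.+1)%N ->
  form_poly (fun i : 'I_n.+1 => g`_i / 'C(n, i)%:R) = g.
Proof.
move=> szg; apply/polyP => i; rewrite coef_poly.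
case: ltnP => [lt_in|le_ni]; last by rewrite nth_default // (leq_trans szg).
by rewrite inordK // mulrC divfK // bin_neq0.
Qed.

Lemma dehomZ x F : dehom (x *: F) = x *: dehom F.
Proof. by rewrite /dehom mmapZ mul_polyC. Qed.

Lemma dehomM F G : dehom (F * G) = dehom F * dehom G.
Proof. exact: rmorphM. Qed.

Lemma dehom_sum n (F : 'I_n -> {mpoly K[2]}) :
  dehom (\sum_i F i) = \sum_i dehom (F i).
Proof. exact: raddf_sum. Qed.

Lemma dehomXn F n : dehom (F ^+ n) = dehom F ^+ n.
Proof. exact: rmorphXn. Qed.

Lemma dehom_binary_form n (c : 'I_n.+1 -> K) :
  dehom (binary_form c) = form_poly c.
Proof.
rewrite /form_poly poly_def /binary_form dehom_sum; apply: eq_bigr => i _.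
rewrite dehomZ inord_val; congr (_ *: _).
rewrite dehomM !dehomXn /dehom !mmapX !mmap1U /=.
by rewrite expr1n mul1r.
Qed.

Lemma binary_form_homog n (c : 'I_n.+1 -> K) : binary_form c \is n.-homog.
Proof.
apply: rpred_sum => i _; apply: rpredZ.
have X1 (j : 'I_2) : ('X_j : {mpoly K[2]}) \is 1.-homog.
  by rewrite dhomogX /= mdeg1.
have := dhomogM (dhomogMn (n - i) (X1 ord0)) (dhomogMn i (X1 ord_max)).
by rewrite !mul1n subnK // -ltnS.
Qed.

Lemma homog_binary_form n (F : {mpoly K[2]}) : F \is n.-homog ->
  exists c : 'I_n.+1 -> K, F = binary_form c.
Proof.
move=> homF; pose mi (i : nat) := (U_(ord0) *+ (n - i) + U_(ord_max) *+ i)%MM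
  : 'X_{1..2}.
exists (fun i => F@_(mi i) / 'C(n, i)%:R); apply/mpolyP => m.
have [mn|m_n] := eqVneq (mdeg m) n; last first.
  rewrite (dhomog_nemf_coeff homF) //.
  by rewrite (dhomog_nemf_coeff (binary_form_homog _)).
have le_mn : (m ord_max < n.+1)%N.
  by rewrite ltnS -mn mdegE (bigD1 ord_max) //= leq_addr.
have -> : m = mi (Ordinal le_mn).
  apply/mnmP => i; rewrite mnmDE !mulmnE !mnm1E /=.
  have m0 : (n - m ord_max)%N = m ord0.
    rewrite -mn mdegE big_ord_recl big_ord1.
    by rewrite (_ : lift ord0 ord0 = ord_max) ?addnK //; apply: val_inj.
  case: (unliftP ord0 i) => [j|] ->; last by rewrite /= mul1n mul0n addn0 m0.
  rewrite (_ : lift ord0 j = ord_max) ?mul0n ?mul1n //.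
  by apply: val_inj; rewrite /= (ord1 j).
by rewrite binary_form_coef mulrC divfK // bin_neq0 // -ltnS.
Qed.

(** With the order fixed, setting x_1 = 1 loses nothing, so forms may be replaced by polynomials of
    bounded degree. *)
Lemma in_power_locusP r d (a : 'I_d.+1 -> K) : (r %| d)%N ->
  in_power_locus r a <-> (exists i, a i != 0) /\
    exists (g : {poly K}) (x : K), [/\ g != 0, (size g <= r.+1)%N, x != 0
                  & form_poly a = x *: g ^+ (d %/ r)].
Proof.
move=> r_d; split=> -[a_neq0].
  case=> G [homG G_neq0 [x x_neq0 aG]]; split=> //.
  have [b Gb] := homog_binary_form homG.
  exists (form_poly b), x; split=> //; last 1 first.
  - by rewrite -dehom_binary_form aG dehomZ dehomXn Gb
      dehom_binary_form.
  - apply: contra G_neq0 => /eqP b0.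
    rewrite Gb /binary_form big1 // => i _.
    have b00 : form_poly b = form_poly (fun _ : 'I_r.+1 => 0).
      by rewrite b0 /form_poly poly_def big1 // => j _; rewrite mulr0 scale0r.
    by rewrite (form_poly_inj b00) mulr0 scale0r.
  - exact: size_poly.
case=> g [x [g_neq0 szg x_neq0 ag]]; split=> //.
pose b := fun i : 'I_r.+1 => g`_i / 'C(r, i)%:R.
have bg : form_poly b = g by apply: form_poly_surj.
exists (binary_form b); split; first exact: binary_form_homog.
  apply: contra g_neq0 => /eqP b0.
  by rewrite -bg -dehom_binary_form b0 /dehom mmap0.
exists x => //.
have [|e Ge] := @homog_binary_form d (x *: binary_form b ^+ (d %/ r)).
  have := dhomogMn (d %/ r) (binary_form_homog b).
  by rewrite mulnC divnK //; apply: rpredZ.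
have ae : a =1 e.
  apply: form_poly_inj; rewrite ag -[RHS]dehom_binary_form -Ge.
  by rewrite dehomZ dehomXn dehom_binary_form bg.
by rewrite Ge; apply: eq_bigr => i _; rewrite ae.
Qed.

(** The i-th derivative of F(1, t) at 0 is i! 'C(d, i) a_i, and (d - i)!/d! cancels the constant. *)
Lemma flow_meval d (a : 'I_d.+1 -> K) p : (flow (form_poly a) p).[0] = p.@[a].
Proof.
elim/mpoly_gen_ind: p => [x|i|p q IHp IHq|p q IHp IHq].
- by rewrite flowC hornerC mevalC.
- have le_id : (i <= d)%N by rewrite -ltnS.
  rewrite mevalXU /flow mmapX mmap1U hornerZ horner_coef0 coef_derivn addn0.
  rewrite coef_poly ltn_ord inord_val ffactnn -mulr_natr.
  transitivity ('C(d, i)%:R * (i`!%:R * (d - i)`!%:R) / d`!%:R * a i); first ring.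
  by rewrite -!natrM bin_fact // divff ?mul1r // pnatr_eq0 -lt0n fact_gt0.
- by rewrite flowD hornerD mevalD IHp IHq.
- by rewrite flowM hornerM mevalM IHp IHq.
Qed.

(** By [flow_cpow], g times the flow of h_0 is f^(r+1) times the (r+1)-st derivative of g, which is
    zero; the other h_k flow to derivatives of zero. *)
Lemma hilbert_ideal_vanish r d (a : 'I_d.+1 -> K) p :
  (0 < r)%N -> (0 < d)%N -> (r %| d)%N ->
  in_power_locus r a -> hilbert_ideal r p -> p.@[a] = 0.
Proof.
move=> r_gt0 d_gt0 r_d /(in_power_locusP _ r_d)[_ [g [x [g_neq0 szg x_neq0 ag]]]].
have mu_gt0 : (0 < d %/ r)%N by rewrite divn_gt0 // dvdn_leq.
have sza : (size (form_poly a) <= d.+1)%N by apply: size_poly.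
have h00 : flow (form_poly a) (h0 K r d) = 0.
  apply: (mulfI g_neq0); rewrite h0_cpow // mulr0.
  have rmu : (r * (d %/ r))%N = d by rewrite mulnC divnK.
  rewrite ag in sza *; rewrite (flow_cpow _ mu_gt0 d_gt0 rmu sza).
  by rewrite (derivn_poly0 szg) mulr0.
case=> n [q [h [Sh ->]]]; rewrite raddf_sum big1 // => i _ /=.
have [k _ ->] := Sh i; rewrite mevalM mevalZ.
by rewrite -[X in _ * (_ * X)](flow_meval a) flow_iter // h00 -[0]polyC0 derivnC
  polyC0 if_same horner0 !mulr0.
Qed.

Lemma poly_coef0_1 (p : {poly K}) : p`_0 = 1 -> exists u, p = 1 + 'X * u.
Proof.
move=> p0; have /factor_theorem[u pu] : root (p - 1) 0.
  by rewrite rootE horner_coef0 coefB coef1 p0 subrr.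
by exists u; rewrite mulrC -['X]subr0 -pu addrC subrK.
Qed.

(** As g has constant term 1, the perturbation changes the coefficient of X^(n+1) in the power by
    exactly m e and none below. *)
Lemma exp_perturb (g : {poly K}) (e : K) n m : g`_0 = 1 ->
  exists q, (g + e *: 'X^(n.+1)) ^+ m
    = g ^+ m + 'X^(n.+1) * ((m%:R * e)%:P + 'X * q).
Proof.
move=> g0; have [u gu] := poly_coef0_1 g0.
elim: m => [|m [q IHm]]; first by exists 0; rewrite mul0r polyC0 !expr0; ring.
have [w gw] : exists w, g ^+ m = 1 + 'X * w.
  by apply: poly_coef0_1; rewrite -horner_coef0 horner_exp horner_coef0 g0 expr1n.
exists (e%:P * w + u * (m%:R * e)%:P + e%:P * 'X^n * (m%:R * e)%:P
        + (g + e *: 'X^(n.+1)) * q).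
rewrite exprS IHm -[m.+1%:R]natr1 -!mul_polyC [g ^+ m.+1]exprS ['X^_]exprS.
by rewrite gw gu; ring.
Qed.

Lemma root_trunc (B : {poly K}) mu k : (0 < mu)%N -> B`_0 != 0 ->
  exists g : {poly K}, [/\ (size g <= k.+1)%N, g`_0 = 1
    & forall i, (i <= k)%N -> (B`_0 *: g ^+ mu)`_i = B`_i].
Proof.
move=> mu_gt0 B0; elim: k => [|k [g [szg g0 gB]]].
  exists 1; split=> [||i]; rewrite ?size_poly1 ?coef1 //.
  by rewrite leqn0 => /eqP->; rewrite expr1n coefZ coef1 mulr1.
(* The solution of the linear equation for the next coefficient given by [exp_perturb]. *)
pose e := (B`_k.+1 / B`_0 - (g ^+ mu)`_k.+1) / mu%:R.
have [q ge] := exp_perturb e k mu g0.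
exists (g + e *: 'X^(k.+1)); split.
- rewrite (leq_trans (size_polyD _ _)) // geq_max (leq_trans szg) //=.
  by rewrite (leq_trans (size_scale_leq _ _)) // size_polyXn.
- by rewrite coefD coefZ coefXn mulr0 addr0.
move=> i; rewrite ge coefZ coefD coefXnM leq_eqVlt ltnS => /orP[/eqP->|le_ik].
  rewrite ltnn subnn coefD coefC coefXM addr0 /e [mu%:R * _]mulrC divfK.
    by rewrite addrC subrK mulrC divfK.
  by rewrite pnatr_eq0 -lt0n.
by rewrite le_ik addr0 -coefZ gB.
Qed.

(** The first r + 1 coefficients of F(1, t) fix a truncated root g with constant term 1. The scalar
    b_0 stays outside the power, so no root of b_0 is extracted. *)
Lemma power_locus_prefix r d (b : 'I_d.+1 -> K) :
  (0 < r)%N -> (0 < d)%N -> (r %| d)%N -> b ord0 != 0 ->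
  exists2 a, in_power_locus r a
    & a ord0 != 0 /\ forall i : 'I_d.+1, (i <= r)%N -> a i = b i.
Proof.
move=> r_gt0 d_gt0 r_d b0.
have mu_gt0 : (0 < d %/ r)%N by rewrite divn_gt0 // dvdn_leq.
pose B := form_poly b.
have B0 : B`_0 = b ord0.
  by rewrite coef_poly bin0 mul1r; congr b; apply: val_inj; rewrite /= inordK.
have [|g [szg g0 gB]] := @root_trunc B (d %/ r) r mu_gt0; first by rewrite B0.
pose F := b ord0 *: g ^+ (d %/ r).
have szF : (size F <= d.+1)%N.
  rewrite (leq_trans (size_scale_leq _ _)) // (leq_trans (size_poly_exp_leq _ _)) //.
  rewrite ltnS -[X in (_ <= X)%N](divnK r_d) mulnC leq_mul2l.
  by case: (size g) szg => [|l] lt_lr; rewrite ?leq0n ?[(l.+1.-1 <= r)%N]lt_lr orbT.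
pose a i := F`_i / 'C(d, i)%:R.
have aF : form_poly (fun i : 'I_d.+1 => a i) = F by apply: form_poly_surj.
have ab (i : 'I_d.+1) : (i <= r)%N -> a i = b i.
  move=> le_ir; rewrite /a /F -B0 gB // coef_poly ltn_ord inord_val mulrC mulKf //.
  by rewrite bin_neq0 // -ltnS.
have a0 : a (@ord0 d) != 0 by rewrite ab.
exists (fun i => a i) => //.
apply/in_power_locusP => //; split; first by exists ord0.
exists g, (b ord0); split=> //.
by apply: contra_neq (oner_neq0 K) => g00; rewrite -g0 g00 coef0.
Qed.

Lemma alg_upto_meval r d (p : {mpoly K[d.+1]}) (a b : 'I_d.+1 -> K) :
  (r <= d)%N -> alg_upto r p -> (forall i : 'I_d.+1, (i <= r)%N -> a i = b i) ->
  p.@[a] = p.@[b].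
Proof.
move=> le_rd pr ab; elim: pr => [x|i le_ir|f g _ IHf _ IHg|f g _ IHf _ IHg].
- by rewrite !mevalC.
- by rewrite /a_ !mevalXU ab // inordK // ltnS (leq_trans le_ir).
- by rewrite !mevalD IHf IHg.
- by rewrite !mevalM IHf IHg.
Qed.

End Forms.

(** * The two inclusions *)

Section Main.
Variables (K : numFieldType) (r d : nat).
Hypotheses (r_gt0 : (0 < r)%N) (d_gt1 : (1 < d)%N) (r_d : (r %| d)%N).
Implicit Types f : {mpoly K[d.+1]}.

Let d_gt0 : (0 < d)%N. Proof. exact: ltnW. Qed.

Lemma vanish_a0_sat f :
  (forall a, in_power_locus r a -> f.@[a] = 0) -> a0_sat r f.
Proof.
move=> f0; have [n [g gr [m Jfg]]] := a0_reducible_all r_gt0 d_gt1 f.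
suff g0 : g = 0.
  by exists (m + n)%N; move: Jfg; rewrite g0 subr0 mulrA -exprD.
(* Points with b_0 = 0 escape [power_locus_prefix]; the factor a_0 covers them and is cancelled
   afterwards. *)
have : a_ K d 0 * g = 0.
  apply: mpoly_vanish => b; rewrite mevalM /a_ mevalXU.
  have -> : inord 0 = ord0 :> 'I_d.+1 by apply: val_inj; rewrite /= inordK.
  have [->|b0] := eqVneq (b ord0) 0; first by rewrite mul0r.
  have [a Xa [a0 ab]] := power_locus_prefix r_gt0 d_gt0 r_d b0.
  rewrite -(alg_upto_meval (dvdn_leq d_gt0 r_d) gr ab).
  have := hilbert_ideal_vanish r_gt0 d_gt0 r_d Xa Jfg.
  rewrite mevalM mevalB mevalM f0 // mulr0 sub0r rmorphXn /= mevalXU.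
  have -> : inord 0 = ord0 :> 'I_d.+1 by apply: val_inj; rewrite /= inordK.
  move/eqP; rewrite mulf_eq0 expf_eq0 (negPf a0) andbF /= oppr_eq0 => /eqP->.
  by rewrite mulr0.
move/eqP; rewrite mulf_eq0 => /orP[/eqP X0|/eqP //].
have := congr1 (meval (fun=> 1)) X0.
by rewrite /a_ mevalXU meval0 => /eqP; rewrite oner_eq0.
Qed.

Lemma saturation_vanish f a :
  saturation (@hilbert_ideal K r d) (@irrelevant_ideal K d) f ->
  in_power_locus r a -> f.@[a] = 0.
Proof.
case=> n Jf Xa; have [[i ai] _] := Xa.
have : (('X_i ^+ n * f).@[a] = 0).
  apply: (hilbert_ideal_vanish r_gt0 d_gt0 r_d Xa).
  apply/Jf/ideal_pow_expr/ideal_gen_mem.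
  by exists i.
rewrite mevalM rmorphXn /= mevalXU => /eqP.
by rewrite mulf_eq0 expf_eq0 (negPf ai) andbF => /eqP.
Qed.

Lemma in_power_locus_scale (a : 'I_d.+1 -> K) (x : K) :
  x != 0 -> in_power_locus r a ->
  in_power_locus r (fun i : 'I_d.+1 => x * a i).
Proof.
move=> x0 [[i ai] [G [homG G0 [c c0 aG]]]]; split.
  by exists i; rewrite mulf_neq0.
exists G; split=> //; exists (x * c); first by rewrite mulf_neq0.
rewrite -scalerA -aG /binary_form scaler_sumr; apply: eq_bigr => j _.
by rewrite scalerA mulrCA.
Qed.

Lemma meval_scale k f (a : 'I_d.+1 -> K) x : f \is k.-homog ->
  f.@[fun i => x * a i] = x ^+ k * f.@[a].
Proof.
move=> /dhomogP homf; rewrite !mevalE mulr_sumr big_seq [RHS]big_seq.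
apply: eq_bigr => m mf; rewrite mulrCA; congr (_ * _).
rewrite -(homf m mf) /= mdegE -prodrXr -big_split /=; apply: eq_bigr => i _.
by rewrite exprMn.
Qed.

(** The cone over X is stable under nonzero scalings x, and f(x a) is a polynomial in x whose
    coefficients are the values at a of the homogeneous parts. *)
Lemma vanish_pihomog f k (a : 'I_d.+1 -> K) :
  (forall a, in_power_locus r a -> f.@[a] = 0) -> in_power_locus r a ->
  (pihomog mdeg k f).@[a] = 0.
Proof.
move=> f0 Xa; pose n := mmeasure mdeg f.
pose p : {poly K} := \poly_(j < n) (pihomog mdeg j f).@[a].
have fE := @pihomog_partitionE _ _ mdeg n f (leqnn _).
have p0 : p = 0.
  apply: poly_vanish => x x0; have := f0 _ (in_power_locus_scale x0 Xa).
  rewrite {1}fE raddf_sum /= => <-; rewrite horner_poly; apply: eq_bigr => j _.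
  by rewrite (meval_scale _ _ (pihomogP mdeg j f)) mulrC.
have [lt_kn|le_nk] := ltnP k n.
  by have := congr1 (fun q : {poly K} => q`_k) p0; rewrite coef_poly lt_kn coef0.
rewrite pihomogE big_seq_cond big_pred0 ?meval0 // => m; apply/negbTE/negP.
case/andP=> mf /eqP mk; have := mmeasure_mnm_lt mdeg mf; rewrite mk.
by rewrite ltnNge le_nk.
Qed.

Lemma saturation_hilbert_ideal f :
  saturation (@hilbert_ideal K r d) (@irrelevant_ideal K d) f
  <-> power_locus_ideal r f.
Proof.
split=> [satf|].
  (* The generators of I_X are homogeneous, so f is split into its homogeneous parts. *)
  rewrite (@pihomog_partitionE _ _ mdeg _ f (leqnn _)).
  apply: ideal_sum; first exact: ideal_gen_is_ideal.
  move=> k; apply: ideal_gen_mem.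
  split; first by exists k; apply: pihomogP.
  by move=> a; apply: vanish_pihomog => b; apply: saturation_vanish.
case=> n [q [g [Sg ->]]]; apply: saturation_a0_sat => //.
apply: vanish_a0_sat => a Xa; rewrite raddf_sum big1 // => i _ /=.
by rewrite mevalM (proj2 (Sg i)) // mulr0.
Qed.

End Main.

Theorem theorem1p2 (R : realType) (r d : nat)
  (hr : (1 <= r)%N) (hd : (2 <= d)%N) (hrd : (r %| d)%N)
  (f : {mpoly R[i][d.+1]}) :
  saturation (@hilbert_ideal R[i] r d) (@irrelevant_ideal R[i] d) f
  <-> power_locus_ideal r f.
Proof. exact: saturation_hilbert_ideal. Qed.
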